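(* Let $q$ be a prime power and $m$, $r$ positive integers. For each $j\in\{1,\dots,r\}$ let $\mathcal{U}^{(j)}=(\mathcal{U}^{(j)}_1,\dots,\mathcal{U}^{(j)}_{t_j})$ be a sum-rank $\rho_j$-saturating $[\mathbf{n}^{(j)},k_j]_{q^m/q}$ system. Then the direct sum $\mathcal{U}^{(1)}\oplus\cdots\oplus\mathcal{U}^{(r)}$ is an $[(\mathbf{n}^{(1)},\dots,\mathbf{n}^{(r)}),k_1+\cdots+k_r]_{q^m/q}$ system and it is sum-rank $\rho$-saturating for some $\rho\le\rho_1+\cdots+\rho_r$.
   Context: For $\mathbf{n}=(n_1,\dots,n_t)$, an $[\mathbf{n},k]_{q^m/q}$ system is a tuple $(\mathcal{U}_1,\dots,\mathcal{U}_t)$ of $\mathbb{F}_q$-subspaces of $\mathbb{F}_{q^m}^k$ with $\dim_{\mathbb{F}_q}\mathcal{U}_i=n_i$ whose union spans $\mathbb{F}_{q^m}^k$ over $\mathbb{F}_{q^m}$. For an $\mathbb{F}_q$-subspace $W\le\mathbb{F}_{q^m}^k$, $L_W=\{\langle u\rangle_{\mathbb{F}_{q^m}}:u\in W\setminus\{0\}\}\subseteq\mathrm{PG}(k-1,q^m)$. A point set $\mathcal{S}$ is $s$-saturating if every point of $\mathrm{PG}(k-1,q^m)$ lies in the $\mathbb{F}_{q^m}$-span of some $s+1$ points of $\mathcal{S}$ and $s$ is minimal with this property; a system is sum-rank $\rho$-saturating if the union of the linear sets of its components is $(\rho-1)$-saturating. The direct sum $\mathcal{U}^{(1)}\oplus\cdots\oplus\mathcal{U}^{(r)}$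 is the tuple of $\mathbb{F}_q$-subspaces of $\mathbb{F}_{q^m}^{k_1+\cdots+k_r}=\mathbb{F}_{q^m}^{k_1}\oplus\cdots\oplus\mathbb{F}_{q^m}^{k_r}$ consisting of the subspaces $\iota_j(\mathcal{U}^{(j)}_i)$ for $j=1,\dots,r$, $i=1,\dots,t_j$ (in this order), where $\iota_j$ is the inclusion of $\mathbb{F}_{q^m}^{k_j}$ as the $j$-th summand; equivalently, it is the system whose generator matrix is the block diagonal matrix with diagonal blocks generator matrices $G^{(1)},\dots,G^{(r)}$ of the $\mathcal{U}^{(j)}$. *)

(* Defs.v *)
From HB Require Import structures.
From mathcomp Require Import all_boot all_order all_algebra all_field.

Set Implicit Arguments.
Unset Strict Implicit.
Unset Printing Implicit Defensive.

Import GRing.Theory.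
Local Open Scope ring_scope.

(* For F = F_q and L = F_{q^m}, the space L^k carries two vector space        *)
(* structures on the same carrier: Fvec L k is L^k over F, and Lvec L k is    *)
(* L^k over L (L^o is L seen as a vector space over itself).                  *)
Notation Fvec L k := {ffun 'I_k -> L}.
Notation Lvec L k := {ffun 'I_k -> L^o}.

Section Systems.
Variables (F : finFieldType) (L : fieldExtType F).

Definition Lspan k (A : Lvec L k -> Prop) (v : Lvec L k) : Prop :=
  exists2 s : seq (Lvec L k), (forall u, u \in s -> A u) & v \in <<s>>%VS.

Definition is_system k (n : seq nat) (U : seq {vspace Fvec L k}) : Prop :=
  [seq \dim W | W <- U] = n /\
  (forall v : Lvec L k,
     Lspan (fun u : Fvec L k => exists2 W, W \in U & u \in W) v).

(* The points of PG(k - 1, q^m) are the P : {vspace Lvec L k} of dimension 1; *)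
(* note that [<[u]>] below is the span of u over L.                           *)
Definition linear_set k (W : {vspace Fvec L k}) (P : {vspace Lvec L k}) : Prop :=
  exists u : Fvec L k, [/\ u \in W, u != 0 & P = <[u : Lvec L k]>%VS].

Definition saturates k (S : {vspace Lvec L k} -> Prop) (s : nat) : Prop :=
  forall P : {vspace Lvec L k}, \dim P = 1%N ->
  exists Q : 'I_s.+1 -> {vspace Lvec L k},
    (forall i, S (Q i)) /\ (P <= \sum_i Q i)%VS.

(* The s + 1 points in [saturates] may repeat. Requiring them to be distinct  *)
(* would not change the least s: if s is least, some point needs s + 1        *)
(* distinct elements of S, so any shorter list can be completed.              *)
Definition saturating k (S : {vspace Lvec L k} -> Prop) (s : nat) : Prop :=
  saturates S s /\ (forall s', saturates S s' -> (s <= s')%N).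

Definition sumrank_saturating k (rho : nat) (U : seq {vspace Fvec L k}) : Prop :=
  (0 < rho)%N /\
  saturating (fun P => exists2 W, W \in U & linear_set W P) rho.-1.

Section DirectSum.
Variables (r : nat) (k : 'I_r -> nat).

(* [tagnat.sig] sends a coordinate of L^(k_1 + ... + k_r) to the pair (block, *)
(* position in the block), blocks being consecutive and in increasing order.  *)
Definition iota_block (j : 'I_r) (u : Fvec L (k j)) : Fvec L (\sum_i k i)%N :=
  [ffun x => untag 0 (fun l : 'I_(k j) => u l) (tagnat.sig x)].

Lemma iota_block_linear j : linear (@iota_block j).
Proof.
move=> a u v; apply/ffunP=> x; rewrite !ffunE /untag.
by case: eqP => [e|_]; rewrite ?ffunE ?scaler0 ?addr0.
Qed.

HB.instance Definition _ j :=
  GRing.isLinear.Build F (Fvec L (k j)) (Fvec L (\sum_i k i)%N) _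
    (@iota_block j) (@iota_block_linear j).

Definition direct_sum (U : forall j, seq {vspace Fvec L (k j)}) :
    seq {vspace Fvec L (\sum_i k i)%N} :=
  flatten [seq [seq (linfun (@iota_block j) @: W)%VS | W <- U j] | j <- enum 'I_r].

End DirectSum.
End Systems.

(* Main.v *)
(* A sum-rank rho-saturating system is one for which every vector of L^k lies in
   the span of at most rho points of the system, rho being the least positive
   such number. Being covered by few points is additive in the vector and is
   transported by linear maps, so split a vector of L^(k_1 + ... + k_r) into its
   r blocks, cover the j-th block by at most rho_j points of the j-th system and
   collect the images of these points: at most rho_1 + ... + rho_r points of the
   direct sum are needed. *)
Require Import Defs.
From HB Require Import structures.
From mathcomp Require Import all_boot all_order all_algebra all_field.
From mathcomp Require Import boolp.

Set Implicit Arguments.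
Unset Strict Implicit.
Unset Printing Implicit Defensive.

Import GRing.Theory.
Local Open Scope ring_scope.

Lemma lker0_dim_limg (K : fieldType) (aT rT : vectType K) (f : 'Hom(aT, rT))
    (U : {vspace aT}) :
  lker f == 0%VS -> \dim (f @: U) = \dim U.
Proof. by move=> /eqP f_inj; rewrite limg_dim_eq // f_inj capv0. Qed.

Section CoveredBy.
Variable K : fieldType.

Definition covered_by (V : vectType K) (S : {vspace V} -> Prop) (n : nat)
    (v : V) : Prop :=
  exists Qs : seq {vspace V},
    [/\ (size Qs <= n)%N, forall Q, Q \in Qs -> S Q
      & v \in (\sum_(Q <- Qs) Q)%VS].

Lemma covered_by0 (V : vectType K) (S : {vspace V} -> Prop) n :
  covered_by S n 0.
Proof. by exists [::]; rewrite mem0v. Qed.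

Lemma covered_byD (V : vectType K) (S : {vspace V} -> Prop) m n u v :
  covered_by S m u -> covered_by S n v ->
  covered_by S (m + n) (u + v).
Proof.
move=> [Ps [szP SP uP]] [Qs [szQ SQ vQ]]; exists (Ps ++ Qs); split.
- by rewrite size_cat leq_add.
- by move=> Q; rewrite mem_cat => /orP[/SP|/SQ].
- by rewrite big_cat memv_add.
Qed.

Lemma covered_by_sum (V : vectType K) (S : {vspace V} -> Prop) (I : Type)
    (s : seq I) (n : I -> nat) (v : I -> V) :
  (forall i, covered_by S (n i) (v i)) ->
  covered_by S (\sum_(i <- s) n i)%N (\sum_(i <- s) v i).
Proof.
move=> Sv; elim/big_rec2: _ => [|i m u _]; first exact: covered_by0.
exact: covered_byD.
Qed.

Lemma covered_by_img (V W : vectType K) (f : 'Hom(V, W))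
    (S : {vspace V} -> Prop) (T : {vspace W} -> Prop) n v :
  (forall Q, S Q -> T (f @: Q)%VS) ->
  covered_by S n v -> covered_by T n (f v).
Proof.
move=> fS [Qs [szQ SQ vQ]]; exists [seq (f @: Q)%VS | Q <- Qs]; split.
- by rewrite size_map.
- by move=> _ /mapP[Q /SQ/fS TfQ ->].
- by rewrite big_map -limg_sum memv_img.
Qed.

End CoveredBy.

Section Saturation.
Variables (F : finFieldType) (L : fieldExtType F) (k : nat).

Lemma saturatesP (S : {vspace Lvec L k} -> Prop) s :
  saturates S s <-> forall v, covered_by S s.+1 v.
Proof.
split=> [satS v | covS P dimP].
  have [->|v0] := eqVneq v 0; first exact: covered_by0.
  have [|Q [SQ leQ]] := satS <[v]>%VS; first by rewrite dim_vline v0.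
  exists [seq Q i | i <- enum 'I_s.+1]; split.
  - by rewrite size_map size_enum_ord.
  - by move=> _ /mapP[i _ ->].
  - by rewrite big_map big_enum memvE.
have P0 : vpick P != 0 by rewrite vpick0 -dimv_eq0 dimP.
have defP : P = <[vpick P]>%VS.
  by apply/esym/eqP; rewrite eqEdim -memvE memv_pick dimP dim_vline P0.
have [[|Q0 Qs] [szQ SQ]] := covS (vpick P); rewrite memvE -defP => leP.
  by move: leP; rewrite big_nil subv0 -dimv_eq0 dimP.
(* Q0 pads the list to exactly s + 1 points. *)
exists (fun i : 'I_s.+1 => nth Q0 (Q0 :: Qs) i); split=> [i|].
  apply: SQ; have [lt_i|ge_i] := ltnP i (size (Q0 :: Qs)); first exact: mem_nth.
  by rewrite nth_default // mem_head.
apply: subv_trans leP _; rewrite (big_nth Q0) big_mkord.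
by apply/subv_sumP => i _; apply: (sumv_sup (widen_ord szQ i)).
Qed.

Lemma ex_saturating (S : {vspace Lvec L k} -> Prop) s :
  saturates S s -> exists2 s', (s' <= s)%N & saturating S s'.
Proof.
move=> /asboolP satS; have exS : exists s', `[< saturates S s' >] by exists s.
case: (ex_minnP exS) => t /asboolP sat_t min_t.
by exists t; [exact: min_t | split=> // s' /asboolP/min_t].
Qed.

Definition system_vector (U : seq {vspace Fvec L k}) (u : Fvec L k) : Prop :=
  exists2 W, W \in U & u \in W.

Definition system_point (U : seq {vspace Fvec L k}) (P : {vspace Lvec L k}) :
    Prop :=
  exists2 W, W \in U & linear_set W P.

Lemma sumrank_saturating_covered (U : seq {vspace Fvec L k}) rho v :
  sumrank_saturating rho U -> covered_by (system_point U) rho v.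
Proof. by move=> [rho_gt0 [/saturatesP + _]]; rewrite prednK // => /(_ v). Qed.

Lemma ex_sumrank_saturating (U : seq {vspace Fvec L k}) n :
    (0 < n)%N -> (forall v, covered_by (system_point U) n v) ->
  exists2 rho, (rho <= n)%N & sumrank_saturating rho U.
Proof.
case: n => // s _ /saturatesP /ex_saturating[t le_ts sat_t].
by exists t.+1.
Qed.

End Saturation.

Section Images.
Variables (F : finFieldType) (L : fieldExtType F).

Lemma Lspan_sum k (A : Lvec L k -> Prop) (I : Type) (s : seq I)
    (v : I -> Lvec L k) :
  (forall i, Lspan A (v i)) -> Lspan A (\sum_(i <- s) v i).
Proof.
move=> Av; elim/big_rec: _ => [|i u _ [X AX uX]].
  by exists [::]; rewrite ?mem0v.
have [Y AY vY] := Av i; exists (Y ++ X); last by rewrite span_cat memv_add.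
by move=> w; rewrite mem_cat => /orP[/AY|/AX].
Qed.

Lemma Lspan_img k l (g : 'Hom(Lvec L k, Lvec L l)) (A : Lvec L k -> Prop)
    (B : Lvec L l -> Prop) v :
  (forall u, A u -> B (g u)) -> Lspan A v -> Lspan B (g v).
Proof.
move=> gA [X AX vX]; exists (map g X); last by rewrite -limg_span memv_img.
by move=> _ /mapP[u /AX/gA Bgu ->].
Qed.

Lemma linear_set_img k l (f : 'Hom(Fvec L k, Fvec L l))
    (g : 'Hom(Lvec L k, Lvec L l)) W P :
  lker f == 0%VS -> f =1 g ->
  linear_set W P -> linear_set (f @: W)%VS (g @: P)%VS.
Proof.
move=> /lker0P f_inj fg [u [Wu u0 ->]]; exists (f u); split.
- exact: memv_img.
- by rewrite -(linear0 f) (inj_eq f_inj).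
- by rewrite limg_line fg.
Qed.

End Images.

Section DirectSum.
Variables (F : finFieldType) (L : fieldExtType F) (r : nat) (k : 'I_r -> nat).

Definition block_inclF (j : 'I_r) : 'Hom(Fvec L (k j), Fvec L (\sum_i k i)%N) :=
  linfun (@iota_block F L r k j).

(* A separate constant: [iota_block] itself already carries its F-linear
   structure. *)
Definition iota_blockL (j : 'I_r) (u : Lvec L (k j)) : Lvec L (\sum_i k i)%N :=
  @iota_block F L r k j u.

Lemma iota_blockL_linear j : linear (@iota_blockL j).
Proof.
move=> a u v; apply/ffunP=> x; rewrite !ffunE /untag.
by case: eqP => [e|_]; rewrite ?ffunE ?scaler0 ?addr0.
Qed.

HB.instance Definition _ j :=
  GRing.isLinear.Build L (Lvec L (k j)) (Lvec L (\sum_i k i)%N) _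
    (@iota_blockL j) (@iota_blockL_linear j).

Definition block_inclL (j : 'I_r) : 'Hom(Lvec L (k j), Lvec L (\sum_i k i)%N) :=
  linfun (@iota_blockL j).

Lemma eq_block_incl j : block_inclF j =1 block_inclL j.
Proof. by move=> u; rewrite !lfunE. Qed.

Definition block_proj (j : 'I_r) (v : Lvec L (\sum_i k i)%N) : Lvec L (k j) :=
  [ffun l => v (tagnat.Rank j l)].

Lemma block_inclLK j : cancel (block_inclL j) (block_proj j).
Proof.
move=> u; apply/ffunP => l; rewrite lfunE !ffunE /tagnat.Rank tagnat.rankK.
have tag_l : tag (Tagged (fun i => 'I_(k i)) l) = j by [].
by rewrite (untagE _ _ tag_l) (eq_axiomK tag_l).
Qed.

Lemma lker_block_inclF j : lker (block_inclF j) == 0%VS.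
Proof.
by apply/lker0P => u v; rewrite !eq_block_incl => /(can_inj (@block_inclLK j)).
Qed.

Lemma sum_block_proj (v : Lvec L (\sum_i k i)%N) :
  \sum_j block_inclL j (block_proj j v) = v.
Proof.
apply/ffunP => x; rewrite sum_ffunE (bigD1 (tag (tagnat.sig x))) //=.
rewrite [X in _ + X]big1 => [|j neq_j]; last first.
  by rewrite lfunE ffunE untag_dflt // eq_sym.
rewrite addr0 lfunE ffunE (untagE _ _ (erefl (tag (tagnat.sig x)))) ffunE.
by rewrite /= -tagnat.rankE tagnat.sigK.
Qed.

Variable U : forall j, seq {vspace Fvec L (k j)}.

Lemma mem_direct_sum j W :
  W \in U j -> (block_inclF j @: W)%VS \in direct_sum U.
Proof.
by move=> UW; apply/flatten_mapP; exists j; [rewrite mem_enum | apply: map_f].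
Qed.

Lemma dim_direct_sum :
  [seq \dim W | W <- direct_sum U] =
  flatten [seq [seq \dim W | W <- U j] | j <- enum 'I_r].
Proof.
rewrite map_flatten -map_comp; congr flatten; apply: eq_map => j /=.
rewrite -map_comp; apply: eq_map => W /=.
exact/lker0_dim_limg/lker_block_inclF.
Qed.

Lemma system_vector_direct_sum j u :
  system_vector (U j) u -> system_vector (direct_sum U) (block_inclL j u).
Proof.
move=> [W UW Wu]; exists (block_inclF j @: W)%VS; first exact: mem_direct_sum.
by rewrite -eq_block_incl memv_img.
Qed.

Lemma system_point_direct_sum j P :
  system_point (U j) P -> system_point (direct_sum U) (block_inclL j @: P)%VS.
Proof.
move=> [W UW WP]; exists (block_inclF j @: W)%VS; first exact: mem_direct_sum.
exact: (linear_set_img (lker_block_inclF j) (@eq_block_incl j) WP).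
Qed.

Lemma is_system_direct_sum (n : 'I_r -> seq nat) :
  (forall j, is_system (n j) (U j)) ->
  is_system (flatten [seq n j | j <- enum 'I_r]) (direct_sum U).
Proof.
move=> sysU; split=> [|v].
  by rewrite dim_direct_sum; congr flatten; apply: eq_map => j; case: (sysU j).
rewrite -(sum_block_proj v); apply: Lspan_sum => j.
have [_ /(_ (block_proj j v))] := sysU j.
by apply: Lspan_img => u; apply: system_vector_direct_sum.
Qed.

Lemma covered_by_direct_sum (n : 'I_r -> nat) v :
  (forall j w, covered_by (system_point (U j)) (n j) w) ->
  covered_by (system_point (direct_sum U)) (\sum_j n j)%N v.
Proof.
move=> covU; rewrite -(sum_block_proj v); apply: covered_by_sum => j.
by apply: covered_by_img (covU j _); apply: system_point_direct_sum.
Qed.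

End DirectSum.

Local Close Scope ring_scope.

Theorem theorem2p7 (F : finFieldType) (L : fieldExtType F) (q m r : nat)
    (card_F : #|F| = q) (dim_L : \dim {:L} = m) (r_gt0 : 0 < r)
    (k : 'I_r -> nat) (n : 'I_r -> seq nat)
    (U : forall j : 'I_r, seq {vspace Fvec L (k j)}) (rho : 'I_r -> nat)
    (sysU : forall j, is_system (n j) (U j))
    (satU : forall j, sumrank_saturating (rho j) (U j)) :
  is_system (flatten [seq n j | j <- enum 'I_r]) (direct_sum U) /\
  exists2 rho' : nat,
    rho' <= \sum_(j < r) rho j & sumrank_saturating rho' (direct_sum U).
Proof.
split; first exact: is_system_direct_sum.
apply: ex_sumrank_saturating => [|v].
  have [rho_gt0 _] := satU (Ordinal r_gt0).
  by rewrite (bigD1 (Ordinal r_gt0)) //= ltn_addr.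
apply: covered_by_direct_sum => j w.
exact: sumrank_saturating_covered.
Qed.
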